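(* For all $1\leq i\leq d$ there exist numbers $f(i,d)$ and $g(i,d)$ with the following property. Let $\mathcal{F}$ be a finite $(d+1)$-colored family of convex sets in $\mathbb{R}^d$ that satisfies $\mathcal{CH}(\mathcal{F}_1,\dots,\mathcal{F}_{d+1})$. Then there exist $k\in[d]$ and a relabeling of the color classes $\mathcal{F}_1,\dots,\mathcal{F}_{d+1}$ of $\mathcal{F}$ such that (1) $\bigcup_{1\leq j\leq k}\mathcal{F}_j$ can be pierced by $f(k,d)$ points, and (2) $\bigcup_{k<j\leq d+1}\mathcal{F}_j$ can be crossed by $g(k,d)$ $k$-flats.
   Context: A finite family $\mathcal{F}$ of convex sets is $m$-colored if each set is colored with (at least) one of $m$ colors; $\mathcal{F}=\mathcal{F}_1\cup\dots\cup\mathcal{F}_m$, where $\mathcal{F}_i$ is the class of sets with color $i$. The family has the Colorful Helly property $\mathcal{CH}(\mathcal{F}_1,\dots,\mathcal{F}_m)$ if every rainbow selection $K_i\in\mathcal{F}_i$, $1\le i\le m$, satisfies $\bigcap_{i=1}^m K_i\neq\emptyset$. A $k$-flat is a $k$-dimensional affine subspace of $\mathbb{R}^d$. A collection $X$ of points (resp. $k$-flats) pierces/crosses a family if every set of the family is intersected by some member of $X$.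
   Formalization: Every color class is assumed nonempty; with an empty class the Colorful Helly property is vacuous and the claim fails, e.g. d = 2, one empty class and two classes of many singletons in general position. *)

(* Defs.v *)
From mathcomp Require Export all_boot all_order all_algebra perm.
From mathcomp Require Export boolp classical_sets functions cardinality reals.
From mathcomp Require Export convex.

Set Implicit Arguments.
Unset Strict Implicit.
Unset Printing Implicit Defensive.

Import GRing.Theory.

Local Open Scope classical_set_scope.
Local Open Scope card_scope.
Local Open Scope ring_scope.

(* A set may belong to several color classes. *)
Definition colored (T : Type) (m : nat) (F : set (set T))
    (C : 'I_m -> set (set T)) : Prop :=
  F = \bigcup_(i in [set: 'I_m]) C i.

Definition colorful_helly (T : Type) (m : nat)
    (C : 'I_m -> set (set T)) : Prop :=
  forall K : 'I_m -> set T, (forall i, C i (K i)) ->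
    \bigcap_(i in [set: 'I_m]) K i !=set0.

Definition flat (R : realType) (d k : nat) (L : set 'rV[R]_d) : Prop :=
  exists (p : 'rV[R]_d) (U : {vspace 'rV[R]_d}),
    \dim U = k /\ L = [set x | x - p \in U].

Definition pierces (T : Type) (X : set T) (F : set (set T)) : Prop :=
  forall K, F K -> exists2 x, X x & K x.

Definition crosses (T : Type) (X : set (set T)) (F : set (set T)) : Prop :=
  forall K, F K -> exists2 L, X L & K `&` L !=set0.

(* "By n points" and "by n k-flats" mean at most n of them. *)
Definition pierced_by_points (T : Type) (n : nat) (F : set (set T)) : Prop :=
  exists2 X : set T, X #<= `I_n & pierces X F.

Definition crossed_by_flats (R : realType) (d k n : nat)
    (F : set (set 'rV[R]_d)) : Prop :=
  exists X : set (set 'rV[R]_d),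
    [/\ X #<= `I_n, forall L, X L -> flat k L & crosses X F].

(* Main.v *)
(* Call a class good if, for a suitable constant m, any m of its members
   (repetitions allowed) contain d + 1 with a common point.  A good class is
   pierced by boundedly many points: this is the (p, d + 1)-theorem of Alon and
   Kleitman (fractional Helly, duality by multiplicative weights, weak
   epsilon-nets).  Let k be the number of good classes, so that a bad class C
   leaves d - k other bad ones, each with a sequence of m members of which no
   d + 1 meet.  A member of C meets every rainbow intersection of these
   sequences.  Using them one at a time, suppose boundedly many flats cross all
   convex sets of this kind.  For K in C and the members B_j of the next
   sequence, some flat crosses d + 1 of the sets K `&` B_j by pigeonhole; these
   B_j have no common point, so on that flat boundedly many hyperplanes cross all
   such K.  Each step lowers the dimension by one, which ends with k-flats.  If
   k = 0, these are boundedly many points piercing a bad class, which is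
   impossible for m large. *)

Require Import Defs.
From mathcomp Require Import interval_inference topology normedtype derive.
From mathcomp Require Import ring lra.

Set Implicit Arguments.
Unset Strict Implicit.
Unset Printing Implicit Defensive.

Import Order.TTheory GRing.Theory Num.Theory.
Import numFieldNormedType.Exports.

Local Open Scope classical_set_scope.
Local Open Scope ring_scope.

(** * Convex hulls and Radon-type theorems *)

Section Hull.
Variables (R : realType) (V : lmodType R).
Implicit Types A : set V.

Lemma convex_setP A : convex_set A <->
  forall x y t, 0 <= t <= 1 -> A x -> A y -> A (t *: x + (1 - t) *: y).
Proof.
split=> [cA x y t t01 Ax Ay|cA x y t].
  have t01' : (Itv.spec (@Itv.num_sem R) (Itv.Real `[0, 1]%Z) t).
    by rewrite /= /Itv.num_sem /= num_real /= in_itv /= !mulr0z !mulr1z.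
  have := cA x y (Itv.mk t01') (mem_set Ax) (mem_set Ay).
  by move/set_mem.
move=> /set_mem Ax /set_mem Ay; apply/mem_set; apply: cA => //.
by apply/andP; split.
Qed.

Definition conv_weights (I : finType) (P : pred I) (l : I -> R) :=
  [/\ forall i, 0 <= l i, forall i, ~~ P i -> l i = 0 & \sum_i l i = 1].

Definition hull (I : finType) (x : I -> V) (P : pred I) : set V :=
  [set z | exists2 l, conv_weights P l & z = \sum_i l i *: x i].

Lemma hull_sub_convex A (I : finType) (x : I -> V) (P : pred I) :
  convex_set A -> (forall i, P i -> A (x i)) -> hull x P `<=` A.
Proof.
move=> /convex_setP cA PA _ [l [l0 lP l1] ->].
suff H (r : seq I) : 0 < \sum_(i <- r) l i ->
    A ((\sum_(i <- r) l i)^-1 *: \sum_(i <- r) l i *: x i).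
  by have := H (index_enum I); rewrite l1 ltr01 invr1 scale1r; exact.
elim: r => [|a r IHr]; first by rewrite big_nil ltxx.
rewrite !big_cons => pos.
have s0 : 0 <= \sum_(i <- r) l i by apply: sumr_ge0 => i _.
case: (boolP (P a)) => [Pa|nPa]; last first.
  by move: pos; rewrite (lP _ nPa) scale0r !add0r; exact: IHr.
have Aa := PA _ Pa.
case: (ltrP 0 (\sum_(i <- r) l i)) => [sgt|sle]; last first.
  have sE : \sum_(i <- r) l i = 0 by apply/eqP; rewrite eq_le sle s0.
  have -> : \sum_(i <- r) l i *: x i = 0.
    apply: big1_seq => i /andP[_ ir].
    move/eqP: sE; rewrite psumr_eq0 // => /allP /(_ _ ir) /= /eqP ->.
    by rewrite scale0r.
  move: pos; rewrite sE !addr0 => la.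
  by rewrite scalerA mulVf ?gt_eqF // scale1r.
set s := \sum_(i <- r) l i in sgt pos *; set S := \sum_(i <- r) _.
have -> : (l a + s)^-1 *: (l a *: x a + S) =
    (l a / (l a + s)) *: x a + (1 - l a / (l a + s)) *: (s^-1 *: S).
  rewrite scalerDr !scalerA; congr (_ *: _ + _ *: _); first by rewrite mulrC.
  by field; rewrite (gt_eqF pos) (gt_eqF sgt).
apply: cA => //; last exact: IHr.
by rewrite divr_ge0 //= ?(ltW pos) // ler_pdivrMr // mul1r lerDl.
Qed.

Lemma mem_hull (I : finType) (x : I -> V) (P : pred I) i : P i ->
  hull x P (x i).
Proof.
move=> Pi; exists (fun j => (j == i)%:R).
  split=> [j|j nPj|]; first exact: ler0n.
    by case: eqP nPj => // ->; rewrite Pi.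
  by rewrite (bigD1 i) //= eqxx big1 ?addr0 // => j /negPf ->.
rewrite (bigD1 i) //= eqxx scale1r big1 ?addr0 // => j /negPf ->.
by rewrite scale0r.
Qed.

Lemma convex_hull (I : finType) (x : I -> V) (P : pred I) :
  convex_set (hull x P).
Proof.
apply/convex_setP => _ _ t /andP[t0 t1] [l [l0 lP l1] ->] [m [m0 mP m1] ->].
exists (fun i => t * l i + (1 - t) * m i).
  split=> [i|i nPi|].
  - by rewrite addr_ge0 // mulr_ge0 // subr_ge0.
  - by rewrite lP // mP // !mulr0 addr0.
  - by rewrite big_split /= -!mulr_sumr l1 m1; ring.
rewrite !scaler_sumr -big_split; apply: eq_bigr => i _ /=.
by rewrite !scalerA scalerDl.
Qed.

Definition convex_closure (A : set V) : set V :=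
  [set z | forall B, convex_set B -> A `<=` B -> B z].

Lemma convex_convex_closure A : convex_set (convex_closure A).
Proof.
apply/convex_setP => x y t t01 Ax Ay B cB AB.
by have /convex_setP := cB; apply => //; [exact: Ax|exact: Ay].
Qed.

Lemma convex_closureS A B : A `<=` B -> convex_closure A `<=` convex_closure B.
Proof. by move=> AB z Az C cC BC; apply: Az => //; exact: subset_trans BC. Qed.

Lemma convexI (I : Type) (P : set I) (K : I -> set V) :
  (forall i, P i -> convex_set (K i)) -> convex_set (\bigcap_(i in P) K i).
Proof.
move=> cK; apply/convex_setP => x y t t01 Kx Ky i Pi.
by have /convex_setP := cK _ Pi; apply => //; [exact: Kx|exact: Ky].
Qed.

End Hull.

Section Radon.
Variables (R : realType) (d : nat).
Local Notation E := 'rV[R]_d.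

Lemma radon (x : 'I_d.+2 -> E) : exists (P : pred 'I_d.+2) z,
  hull x P z /\ hull x (predC P) z.
Proof.
pose M : 'M[R]_(d.+2, d + 1) := \matrix_i row_mx (x i) (const_mx 1).
have : kermx M != 0.
  rewrite kermx_eq0 /row_free neq_ltn; apply/orP; left.
  by rewrite ltnS (leq_trans (rank_leq_col M)) // addn1.
move=> /rowV0Pn[u /sub_kermxP uM unz].
have uME : \sum_i u 0 i *: x i = 0 /\ \sum_i u 0 i = 0.
  have : \sum_i u 0 i *: row i M = 0 by rewrite -mulmx_sum_row.
  under eq_bigr => i _ do rewrite rowK scale_row_mx.
  move=> H; split.
    have := congr1 lsubmx H; rewrite linear_sum linear0 /=.
    by under eq_bigr => i _ do rewrite row_mxKl.
  have := congr1 rsubmx H; rewrite linear_sum linear0 /=.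
  under eq_bigr => i _ do rewrite row_mxKr.
  move/(congr1 (fun A : 'M[R]_1 => A 0 0)); rewrite /= summxE mxE.
  by move=> H2; rewrite -[RHS]H2; apply: eq_bigr => i _; rewrite !mxE mulr1.
case: uME => ux u1.
pose P : pred 'I_d.+2 := fun i => 0 < u 0 i.
have sPC : \sum_(i | ~~ P i) - u 0 i = \sum_(i | P i) u 0 i.
  by rewrite sumrN; apply/eqP; rewrite eq_sym -addr_eq0; move: u1;
    rewrite (bigID P) /= => ->.
pose s := \sum_(i | P i) u 0 i.
have s0 : 0 < s.
  rewrite lt_neqAle sumr_ge0 ?andbT; last by move=> i /ltW.
  apply: contra unz => /eqP se; apply/eqP/rowP => i; rewrite mxE.
  case: (boolP (P i)) => Pi.
    move/esym/eqP: se; rewrite psumr_eq0; last by move=> j /ltW.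
    by move/allP/(_ i (mem_index_enum _)); rewrite Pi /= => /eqP.
  move: sPC; rewrite -/s -se => /eqP; rewrite psumr_eq0.
    by move/allP/(_ i (mem_index_enum _)); rewrite Pi /= oppr_eq0 => /eqP.
  by move=> j; rewrite oppr_ge0 /P -leNgt.
exists P, (s^-1 *: \sum_(i | P i) u 0 i *: x i); split.
  exists (fun i => if P i then u 0 i / s else 0).
    split=> [i|i /negPf -> //|].
      by case: ifP => // Pi; rewrite divr_ge0 // ltW.
    by rewrite -big_mkcond -mulr_suml mulfV ?gt_eqF.
  rewrite scaler_sumr big_mkcond; apply: eq_bigr => i _.
  by case: ifP => _; rewrite ?scale0r // scalerA mulrC.
exists (fun i => if ~~ P i then (- u 0 i) / s else 0).
  split=> [i|i /negPf /= -> //|].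
    by case: ifP => // Pi; rewrite divr_ge0 // ?(ltW s0) // oppr_ge0 leNgt.
  by rewrite -big_mkcond -mulr_suml sPC mulfV ?gt_eqF.
have -> : \sum_(i | P i) u 0 i *: x i = \sum_(i | ~~ P i) - u 0 i *: x i.
  under [RHS]eq_bigr => i _ do rewrite scaleNr.
  by rewrite sumrN; apply/eqP; rewrite -addr_eq0; move: ux;
    rewrite (bigID P) /= => ->.
rewrite scaler_sumr big_mkcond; apply: eq_bigr => i _.
by case: ifP => _; rewrite ?scale0r // scalerA mulrC.
Qed.

Lemma helly (K : 'I_d.+2 -> set E) : (forall i, convex_set (K i)) ->
  (forall i, exists x, forall j, j != i -> K j x) -> exists x, forall i, K i x.
Proof.
move=> cK /choice[x xP]; have [P [z [zP zC]]] := radon x.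
exists z => i; case: (boolP (P i)) => Pi.
  apply: (hull_sub_convex (cK i) _ zC) => j Pj; apply: xP.
  by apply: contraNneq Pj => <-.
apply: (hull_sub_convex (cK i) _ zP) => j Pj; apply: xP.
by apply: contraNneq Pi => ->.
Qed.

(* The Tverberg number 2r comes from taking d + 2 blocks with Tverberg
   partitions into r parts and a Radon partition of their Tverberg points. *)
Lemma tverberg (r : nat) : exists B : finType, forall x : B -> E,
  exists (c : B -> nat) z, forall j, (j < r)%N ->
    convex_closure (x @` [set b | c b = j]) z.
Proof.
elim: r => [|[|r] [B IH]]; first by exists unit => x; exists (fun=> 0%N), 0.
  exists unit => x; exists (fun=> 0%N), (x tt) => -[|//] _ A _; apply.
  by exists tt.
exists (prod 'I_d.+2 B) => x.
have /choice[c /choice[z cz]] := fun i => IH (fun b => x (i, b)).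
have [P [w [wP wC]]] := radon z.
exists (fun ib => (c ib.1 ib.2).*2 + P ib.1)%N, w => j jr A cA xA.
have jr2 : (j./2 < r.+1)%N.
  by rewrite ltn_half_double (leq_trans jr) // doubleS !ltnS -addnn leq_addr.
have zA i : P i = odd j -> A (z i).
  move=> Pi; apply: (cz i _ jr2) => // _ [b cb <-]; apply: xA.
  exists (i, b) => //=; rewrite cb Pi addnC; exact: odd_double_half.
case: (boolP (odd j)) => oj.
  by apply: (hull_sub_convex cA _ wP) => i Pi; apply: zA; rewrite Pi oj.
by apply: (hull_sub_convex cA _ wC) => i /negPf /= Pi; apply: zA;
  rewrite Pi (negPf oj).
Qed.

End Radon.

(** * Points of least norm *)

Lemma sum_continuous (R : realType) (T : topologicalType) (V : normedModType R)
    (I : Type) (r : seq I) (F : I -> T -> V) :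
  (forall i, continuous (F i)) -> continuous (fun x => \sum_(i <- r) F i x).
Proof.
move=> cF x; elim: r => [|i r IHr].
  by under eq_fun do rewrite big_nil; exact: cvg_cst.
rewrite /continuous_at big_cons; under eq_fun do rewrite big_cons.
by apply: cvgD IHr; exact: cF.
Qed.

Section Dot.
Variables (R : realType) (m n : nat).
Implicit Types (A B C : 'M[R]_(m, n)) (t : R).

Definition dot A B : R := \sum_i \sum_j A i j * B i j.

Lemma dotC A B : dot A B = dot B A.
Proof. by apply: eq_bigr => i _; apply: eq_bigr => j _; rewrite mulrC. Qed.

Lemma dotDr A B C : dot A (B + C) = dot A B + dot A C.
Proof.
rewrite -big_split; apply: eq_bigr => i _; rewrite -big_split.
by apply: eq_bigr => j _ /=; rewrite mxE mulrDr.
Qed.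

Lemma dotZr A t B : dot A (t *: B) = t * dot A B.
Proof.
rewrite mulr_sumr; apply: eq_bigr => i _; rewrite mulr_sumr.
by apply: eq_bigr => j _ /=; rewrite mxE mulrCA.
Qed.

Lemma dotNr A B : dot A (- B) = - dot A B.
Proof. by rewrite -scaleN1r dotZr mulN1r. Qed.

Lemma dotDl A B C : dot (A + B) C = dot A C + dot B C.
Proof. by rewrite dotC dotDr !(dotC C). Qed.

Lemma dotZl A t B : dot (t *: A) B = t * dot A B.
Proof. by rewrite dotC dotZr (dotC B). Qed.

Lemma dotNl A B : dot (- A) B = - dot A B.
Proof. by rewrite dotC dotNr dotC. Qed.

Lemma dot0r A : dot A 0 = 0.
Proof. by rewrite -(scale0r 0) dotZr mul0r. Qed.

Lemma dot_sumr (I : Type) (r : seq I) (P : pred I) A (F : I -> 'M[R]_(m, n)) :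
  dot A (\sum_(i <- r | P i) F i) = \sum_(i <- r | P i) dot A (F i).
Proof. exact: (big_morph (dot A) (dotDr A) (dot0r A)). Qed.

Lemma dot_ge0 A : 0 <= dot A A.
Proof. by do 2![apply: sumr_ge0 => ? _]; exact: sqr_ge0. Qed.

Lemma dot_eq0 A : (dot A A == 0) = (A == 0).
Proof.
apply/idP/eqP => [|->]; last by rewrite dot0r.
rewrite psumr_eq0 => [/allP Hi|i _]; last by apply: sumr_ge0 => j _;
  exact: sqr_ge0.
apply/matrixP => i j; rewrite mxE; apply/eqP.
move: (Hi i (mem_index_enum _)) => /=.
rewrite psumr_eq0 => [/allP Hj|k _]; last exact: sqr_ge0.
by move: (Hj j (mem_index_enum _)); rewrite /= mulf_eq0 orbb.
Qed.

Lemma dot_continuous : continuous (fun A => dot A A).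
Proof.
apply: sum_continuous => i; apply: sum_continuous => j A.
by have c := @coord_continuous R m n i j A; exact: (cvgM c c).
Qed.

Definition is_min_norm (A : set 'M[R]_(m, n)) z :=
  A z /\ forall y, A y -> dot z z <= dot y y.

Lemma min_norm_dot_le (A : set 'M[R]_(m, n)) z y :
  convex_set A -> is_min_norm A z -> A y -> dot z z <= dot z y.
Proof.
move=> /convex_setP cA [Az zmin] Ay; rewrite leNgt; apply/negP => zy.
pose e := dot z z - dot z y; pose q := dot (y - z) (y - z).
have e0 : 0 < e by rewrite subr_gt0.
have q0 : 0 <= q by exact: dot_ge0.
pose t := e / (e + q).
have eq0 : 0 < e + q by rewrite ltr_wpDr.
have t0 : 0 < t by rewrite divr_gt0.
have tq : t * q = e - t * e by rewrite /t; field; rewrite gt_eqF.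
have t1 : t <= 1 by rewrite ler_pdivrMr // mul1r lerDl.
have := zmin _ (cA y z t _ Ay Az); rewrite (ltW t0) t1 => /(_ isT).
have -> : t *: y + (1 - t) *: z = z + t *: (y - z).
  by rewrite scalerBl scale1r scalerBr addrCA.
rewrite dotDl !dotDr !dotZl !dotZr (dotC (y - z) z) -/q.
have -> : dot z (y - z) = - e by rewrite dotDr dotNr /e opprB.
move=> H; have : t * (t * q) >= 2 * t * e by lra.
rewrite tq => H'; have : 2 * e <= e - t * e.
  by rewrite -(ler_pM2l t0); lra.
have : 0 < t * e by rewrite mulr_gt0.
lra.
Qed.

Lemma min_norm_unique (A : set 'M[R]_(m, n)) z y :
  convex_set A -> is_min_norm A z -> is_min_norm A y -> z = y.
Proof.
move=> cA zm ym; apply/eqP; rewrite -subr_eq0 -dot_eq0.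
have zy := min_norm_dot_le cA zm (proj1 ym).
have yz := min_norm_dot_le cA ym (proj1 zm).
rewrite eq_le dot_ge0 andbT dotDl !dotDr !dotNl !dotNr (dotC y z).
by move: yz; rewrite (dotC y z) => yz; lra.
Qed.

Lemma convex_dot_lt r : convex_set [set A | dot A A < r].
Proof.
apply/convex_setP => A B t /andP[t0 t1] /= Ar Br.
have H : 0 <= t * (1 - t) * dot (A - B) (A - B).
  by rewrite !mulr_ge0 ?dot_ge0 // subr_ge0.
have -> : dot (t *: A + (1 - t) *: B) (t *: A + (1 - t) *: B) =
    t * dot A A + (1 - t) * dot B B - t * (1 - t) * dot (A - B) (A - B).
  rewrite !(dotDl, dotDr, dotZl, dotZr, dotNl, dotNr) (dotC B A).
  ring.
have [->|tn0] := eqVneq t 0; first by lra.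
have : t * dot A A < t * r by rewrite ltr_pM2l // lt_neqAle eq_sym tn0.
have : (1 - t) * dot B B <= (1 - t) * r by rewrite ler_wpM2l ?subr_ge0 // ltW.
lra.
Qed.

End Dot.

Section Compactness.
Variables (R : realType) (m n : nat).
Local Notation E := 'M[R]_(m, n).

Lemma compact_hull (I : finType) (x : I -> E) (P : pred I) :
  compact (hull x P).
Proof.
pose N := #|I|.
pose f (l : 'rV[R]_N) : E := \sum_(i < N) l 0 i *: x (enum_val i).
pose D := [set l : 'rV[R]_N | forall i, `[0, 1]%classic (l 0 i)] `&`
  ([set l : 'rV[R]_N | \sum_i l 0 i = 1] `&`
   \bigcap_(i in [set i | ~~ P (enum_val i)]) [set l : 'rV[R]_N | l 0 i = 0]).
have -> : hull x P = f @` D.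
  apply/seteqP; split=> [_ [l [l0 lP l1] ->]|_ [l [l01 [l1 lP]] <-]].
    exists (\row_i l (enum_val i)); last first.
      rewrite /f (reindex (@enum_val I I)) /=;
        last exact: (onW_bij _ (enum_val_bij I)).
      by apply: eq_bigr => i _; rewrite mxE.
    have S1 : \sum_(i < N) (\row_i l (enum_val i)) 0 i = 1.
      rewrite -l1 [RHS](reindex (@enum_val I I)) /=;
        last exact: (onW_bij _ (enum_val_bij I)).
      by apply: eq_bigr => i _; rewrite mxE.
    split; [|split] => //=.
      move=> i; rewrite in_itv /= mxE l0 /= -l1 (bigD1 (enum_val i)) //=.
      by rewrite lerDl sumr_ge0.
    by move=> i /= nPi; rewrite mxE lP.
  exists (fun i => l 0 (enum_rank i)).
    split=> [i|i nPi|].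
    - by have := l01 (enum_rank i); rewrite /= in_itv /= => /andP[].
    - by apply: lP; rewrite /= enum_rankK.
    - rewrite -l1 (reindex (@enum_val I I)) /=;
        last exact: (onW_bij _ (enum_val_bij I)).
      by apply: eq_bigr => i _; rewrite enum_valK.
  rewrite [RHS](reindex (@enum_val I I)) /=;
    last exact: (onW_bij _ (enum_val_bij I)).
  by apply: eq_bigr => i _; rewrite enum_valK.
apply: continuous_compact.
  apply: continuous_subspaceT; apply: sum_continuous => i l.
  by have c := @coord_continuous R 1 N 0 i l;
    exact: (cvgZr_tmp (a := x (enum_val i)) c).
apply: compact_closedI.
  by apply: (@rV_compact R N (fun=> `[0, 1]%classic)) => i;
    exact: segment_compact.
apply: closedI.
  apply: (@preimage_closed _ _ (fun l : 'rV[R]_N => \sum_i l 0 i) [set 1]).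
    move=> l _; apply: sum_continuous => i k;
      exact: (@coord_continuous R 1 N 0 i k).
  exact: closed_eq.
apply: closed_bigI => i _.
apply: (@preimage_closed _ _ (fun l : 'rV[R]_N => l 0 i) [set 0]).
  move=> l _; exact: (@coord_continuous R 1 N 0 i l).
exact: closed_eq.
Qed.

Lemma exists_min_norm (A : set E) : compact A -> A !=set0 ->
  exists z, is_min_norm A z.
Proof.
move=> cA A0.
have [|z /set_mem Az zmin] := compact_EVT_min (f := fun B : E => dot B B) A0 cA.
  by apply: continuous_subspaceT; exact: dot_continuous.
by exists z; split=> // y Ay; apply: zmin; exact: mem_set.
Qed.

End Compactness.

(** * Fractional Helly theorem *)

Lemma gordan (R : realType) (m n : nat) (I : finType) (x : I -> 'M[R]_(m, n)) :
  ~ hull x xpredT 0 -> exists a, forall i, 0 < dot a (x i).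
Proof.
move=> x0; case: (pickP (@predT I)) => [i0 _|I0]; last first.
  by exists 0 => i; have := I0 i.
have [|a amin] := exists_min_norm (@compact_hull _ _ _ _ x xpredT).
  by exists (x i0); exact: mem_hull.
exists a => i; have := min_norm_dot_le (@convex_hull _ _ _ x xpredT) amin
  (@mem_hull _ _ _ x xpredT i isT).
apply: lt_le_trans; rewrite lt_neqAle dot_ge0 andbT eq_sym dot_eq0.
by apply/eqP => a0; apply: x0; rewrite -a0; case: amin.
Qed.

(* The selected points are the points of least norm in the intersections of d
   sets, once the sets are replaced by polytopes with the same nerve. *)
Lemma nerve_selector (R : realType) (d : nat) (I : finType)
    (K : I -> set 'rV[R]_d) : (forall i, convex_set (K i)) ->
  exists v : {ffun 'I_d -> I} -> 'rV[R]_d, forall z : {ffun 'I_d.+1 -> I},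
    (exists x, forall j, K (z j) x) ->
    exists j, K (z j) (v [ffun i => z (lift j i)]).
Proof.
move=> cK.
have /choice[q qP] : forall J : {set I}, exists x : 'rV[R]_d,
    (exists y, forall i, i \in J -> K i y) -> forall i, i \in J -> K i x.
  move=> J; case: (pselect (exists y, forall i, i \in J -> K i y)) => [[y]|n].
    by exists y.
  by exists 0 => /n.
pose P i (J : {set I}) := (i \in J) && `[< exists y, forall i, i \in J ->
  K i y >].
pose L i := hull q (P i).
have LK i : L i `<=` K i.
  by apply: hull_sub_convex => // J /andP[iJ /asboolP HJ]; exact: qP.
have cL i : convex_set (L i) by exact: convex_hull.
pose cap n (z : {ffun 'I_n -> I}) := \bigcap_j L (z j).
exists (fun z => get (is_min_norm (cap d z))) => z [y yz].
have cptL : compact (cap d.+1 z).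
  apply: subclosed_compact (@compact_hull _ _ _ _ q (P (z ord0))) _; last first.
    by move=> x /(_ ord0 Logic.I).
  apply: closed_bigI => i _; apply: compact_closed; last exact: compact_hull.
  exact: norm_hausdorff.
have [|p [pL pmin]] := exists_min_norm cptL.
  pose J := [set z j | j : 'I_d.+1]%SET; exists (q J) => j _.
  apply: mem_hull; rewrite /P imset_f //; apply/asboolP; exists y.
  by move=> _ /imsetP[k _ ->].
pose H (i : 'I_d.+2) := if unlift ord0 i is Some j then L (z j)
  else [set x | dot x x < dot p p].
have H0 : H ord0 = [set x | dot x x < dot p p] by rewrite /H unlift_none.
have HS j : H (lift ord0 j) = L (z j) by rewrite /H liftK.
have nH : ~ exists x, forall i, H i x.
  move=> [x xH]; have := xH ord0; rewrite H0 /= ltNge => /negP; apply.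
  by apply: pmin => j _; rewrite -HS; exact: xH.
have : ~ forall i, exists x, forall j, j != i -> H j x.
  move=> Hi; apply: nH; apply: helly => // i.
  by case: (unliftP ord0 i) => [j|] ->; rewrite ?HS ?H0 //;
    exact: convex_dot_lt.
move/existsNP => [i ni]; case: (unliftP ord0 i) ni => [j|] -> ni; last first.
  exfalso; apply: ni; exists p => k; case: (unliftP ord0 k) => [l|] ->.
    by rewrite HS => _; exact: pL.
  by rewrite eqxx.
exists j; set z' := finfun _.
have capp : is_min_norm (cap d z') p.
  split=> [k _|x xz']; first by rewrite ffunE; exact: pL.
  rewrite leNgt; apply/negP => xp; apply: ni; exists x => k.
  case: (unliftP ord0 k) => [l|] ->; last by rewrite H0.
  rewrite HS (inj_eq lift_inj); case: (unliftP j l) => [k'|] ->;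
    last by rewrite eqxx.
  by move=> _; have := xz' k' Logic.I; rewrite ffunE.
have -> : get (is_min_norm (cap d z')) = p.
  apply: (@min_norm_unique _ _ _ (cap d z')); last exact: capp.
    by apply: convexI => k _; exact: cL.
  exact: (getI capp).
by apply: LK; exact: pL.
Qed.

Section ProductMeasure.
Variables (R : realType) (I : finType) (w : I -> R).
Hypotheses (w0 : forall i, 0 <= w i) (w1 : \sum_i w i = 1).

Definition pr (A : finType) (Q : pred {ffun A -> I}) : R :=
  \sum_(z : {ffun A -> I} | Q z) \prod_a w (z a).

Lemma pr_predT (A : finType) : pr (A := A) predT = 1.
Proof.
rewrite /pr -(bigA_distr_bigA (fun (a : A) i => w i)).
by apply: big1 => a _.
Qed.

Lemma prod_w_ge0 (A : finType) (z : {ffun A -> I}) : 0 <= \prod_a w (z a).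
Proof. exact: prodr_ge0. Qed.

Lemma pr_comp (A B : finType) (phi : A -> B) (Q : pred {ffun A -> I}) :
  injective phi -> pr (fun y : {ffun B -> I} => Q [ffun a => y (phi a)]) = pr Q.
Proof.
move=> iphi; pose h (y : {ffun B -> I}) : {ffun A ->
  I} := [ffun a => y (phi a)].
rewrite /pr (partition_big h Q) //=; apply: eq_bigr => z Qz.
pose F b : pred I := fun i => [forall a, (phi a == b) ==> (i == z a)].
transitivity (\prod_b \sum_(i | F b i) w i).
  rewrite bigA_distr_big_dep; apply: eq_bigl => y.
  apply/andP/familyP => [[_ /eqP hy] b|yF].
    by apply/forallP => a; apply/implyP => /eqP <-; rewrite -hy ffunE.
  have -> : [ffun a => y (phi a)] = z.
    apply/ffunP => a; rewrite ffunE; apply/eqP.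
    by have /forallP/(_ a) := yF (phi a); rewrite eqxx.
  split=> //; apply/eqP/ffunP => a; rewrite ffunE; apply/eqP.
  by have /forallP/(_ a) := yF (phi a); rewrite eqxx.
rewrite (bigID (mem [set phi a | a : A]%SET)) /= [X in _ * X]big1 ?mulr1.
  rewrite big_imset /=; last by move=> a b _ _; exact: iphi.
  apply: eq_big => [a|a _]; first by rewrite inE.
  rewrite (big_pred1 (z a)) // => i; apply/forallP/eqP => [/(_ a)|-> b].
    by rewrite eqxx => /eqP.
  by apply/implyP => /eqP/iphi ->.
move=> b nb; rewrite -w1; apply: eq_bigl => i; apply/forallP => a.
by apply/implyP => /eqP ab; rewrite -ab imset_f in nb.
Qed.

Lemma pr_union_bound (A B T : finType) (phi : T -> A -> B)
    (Q : pred {ffun A -> I}) : (forall t, injective (phi t)) ->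
  (forall y : {ffun B -> I}, exists t, Q [ffun a => y (phi t a)]) ->
  1 <= #|T|%:R * pr Q.
Proof.
move=> iphi QP; rewrite mulr_natl -[leLHS](pr_predT B) -sumr_const.
under eq_bigr => t _ do rewrite -(pr_comp Q (iphi t)).
rewrite /pr (exchange_big_dep xpredT) //=; apply: ler_sum => y _.
have [t Qt] := QP y.
by rewrite (bigD1 t) //= lerDl; apply: sumr_ge0 => *; exact: prod_w_ge0.
Qed.

Lemma pr_lift (d : nat) (j : 'I_d.+1) (Q : {ffun 'I_d -> I} -> pred I) :
  pr (fun z : {ffun 'I_d.+1 -> I} => Q [ffun i => z (lift j i)] (z j)) =
  \sum_(z : {ffun 'I_d -> I}) (\prod_i w (z i)) * \sum_(i | Q z i) w i.
Proof.
pose h (z : {ffun 'I_d.+1 -> I}) : {ffun 'I_d -> I} := [ffun i => z (lift j i)].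
pose g (y : {ffun 'I_d -> I}) i : {ffun 'I_d.+1 -> I} :=
  [ffun k => if unlift j k is Some l then y l else i].
have gj y i : g y i j = i by rewrite ffunE unlift_none.
have gl y i l : g y i (lift j l) = y l by rewrite ffunE liftK.
have hg y i : h (g y i) = y by apply/ffunP => l; rewrite ffunE gl.
rewrite /pr (partition_big h predT) //=; apply: eq_bigr => y _.
rewrite (reindex_onto (g y) (fun z => z j)) /=; last first.
  move=> z /andP[_ /eqP hz]; apply/ffunP => k; rewrite ffunE.
  by case: unliftP => [l|] -> //; rewrite -hz ffunE.
rewrite mulr_sumr; apply: eq_big => [i|i _].
  by rewrite !gj -/(h _) hg !eqxx !andbT.
by rewrite (bigD1_ord j) //= gj mulrC; under eq_bigr => l _ do rewrite gl.
Qed.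

Lemma fractional_helly (d : nat) (K : I -> set 'rV[R]_d) (alpha : R) :
  (forall i, convex_set (K i)) -> 0 < alpha ->
  alpha <= pr (fun z : {ffun 'I_d.+1 ->
    I} => `[< exists x, forall j, K (z j) x >]) ->
  exists x, alpha / d.+2%:R <= \sum_(i | `[< K i x >]) w i.
Proof.
move=> cK a0 ale; have [v vP] := nerve_selector cK.
apply: contrapT => /forallNP nx.
have {}nx x : \sum_(i | `[< K i x >]) w i <= alpha / d.+2%:R.
  by rewrite leNgt; apply/negP => /ltW; exact: nx.
have : alpha <= \sum_(j < d.+1) alpha / d.+2%:R.
  apply: (le_trans ale); apply: (@le_trans _ _ (\sum_(j < d.+1)
      pr (fun z : {ffun 'I_d.+1 -> I} =>
        `[< K (z j) (v [ffun i => z (lift j i)]) >]))).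
    rewrite /pr (exchange_big_dep xpredT) //=;
      rewrite [leRHS](bigID (fun z : {ffun 'I_d.+1 ->
        I} => `[< exists x, forall j, K (z j) x >])) /=.
    apply: ler_wpDr; first by do 2![apply: sumr_ge0 => ? _]; exact: prod_w_ge0.
    apply: ler_sum => z /asboolP/vP[j /asboolP Kj].
    by rewrite [leRHS](bigD1 j) //= lerDl; apply: sumr_ge0 => *;
      exact: prod_w_ge0.
  apply: ler_sum => j _.
  rewrite (pr_lift j (fun z i => `[< K i (v z) >])).
  rewrite -[leRHS]mul1r -[X in X * _](pr_predT 'I_d) /pr mulr_suml.
  apply: ler_sum => z _; apply: ler_wpM2l; first exact: prod_w_ge0.
  exact: nx.
rewrite sumr_const card_ord -[leRHS]mulr_natr -mulrA leNgt => /negP; apply.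
rewrite gtr_pMr // mulrC ltr_pdivrMr ?ltr0Sn // mul1r ltr_nat.
by [].
Qed.

End ProductMeasure.

(** * Weak epsilon-nets and the (p, d + 1)-theorem *)

Lemma pr_curry (R : realType) (I J B : finType) (w : I -> R)
    (Q : pred {ffun J -> {ffun B -> I}}) :
  pr (fun u : {ffun B -> I} => \prod_b w (u b)) Q =
  pr w (fun y : {ffun J * B -> I} => Q [ffun j => [ffun b => y (j, b)]]).
Proof.
pose g (y : {ffun J * B -> I}) : {ffun J -> {ffun B -> I}} :=
  [ffun j => [ffun b => y (j, b)]].
pose f (z : {ffun J -> {ffun B -> I}}) : {ffun J * B -> I} :=
  [ffun jb => z jb.1 jb.2].
have gf : cancel g f by move=> y; apply/ffunP => -[j b]; rewrite !ffunE.
have fg : cancel f g.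
  by move=> z; apply/ffunP => j; apply/ffunP => b; rewrite !ffunE.
rewrite /pr (reindex g) /=; last by apply: onW_bij; exists f.
apply: eq_bigr => y _; rewrite pair_big /=.
by apply: eq_bigr => -[j b] _; rewrite !ffunE.
Qed.

Lemma pr_le1 (R : realType) (I A : finType) (w : I -> R)
    (Q : pred {ffun A -> I}) :
  (forall i, 0 <= w i) -> \sum_i w i = 1 -> pr w Q <= 1.
Proof.
move=> w0 w1; rewrite -(pr_predT w1 A) /pr [leRHS](bigID Q) /= lerDl.
by apply: sumr_ge0 => z _; exact: prod_w_ge0.
Qed.

Section Piercing.
Variables (R : realType) (d : nat).
Local Notation E := 'rV[R]_d.

(* Exchanging row 0 with row [c b] in each column b of a random array moves the
   Tverberg partition c of row 0 into the rows of another random array. *)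
Lemma selection : exists (B : finType) (beta : R), 0 < beta /\
  forall (I : finType) (x : I -> E) (w : I -> R),
  (forall i, 0 <= w i) -> \sum_i w i = 1 -> exists z,
  beta <= pr w (fun u : {ffun B -> I} =>
                  `[< convex_closure (range (fun b => x (u b))) z >]).
Proof.
have [B tB] := @tverberg R d d.+1; exists B.
pose T : finType := {ffun B -> 'I_d.+1}.
have T0 : 0 < #|T|%:R :> R by rewrite ltr0n; apply/card_gt0P;
  exists [ffun=> ord0].
exists (#|T|%:R^-1 / d.+2%:R); split;
  first by rewrite divr_gt0 ?invr_gt0 ?ltr0Sn.
move=> I x w w0 w1.
pose w' (u : {ffun B -> I}) := \prod_b w (u b).
pose K (u : {ffun B -> I}) := convex_closure (range (fun b => x (u b))).
have w'0 u : 0 <= w' u by exact: prod_w_ge0.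
have w'1 : \sum_u w' u = 1 by exact: (pr_predT w1 B).
apply: (@fractional_helly _ _ w' w'0 w'1 d K).
- by move=> u; exact: convex_convex_closure.
- by rewrite invr_gt0.
rewrite pr_curry -[leLHS]mul1r ler_pdivrMr // mulrC.
pose phi (t : T) (a : 'I_d.+1 * B) := (tperm ord0 (t a.2) a.1, a.2).
apply: (pr_union_bound w0 w1 (phi := phi)).
  by move=> t [j b] [j' b'] [+ bb]; rewrite bb => /perm_inj ->.
move=> y; have [c [z cz]] := tB (fun b => x (y (ord0, b))).
exists [ffun b => inord (c b)]; apply/asboolP; exists z => j.
apply: convex_closureS (cz j (ltn_ord j)) => _ [b cb <-]; exists b => //.
by rewrite !ffunE /phi /= ffunE cb inord_val tpermR.
Qed.

Lemma weak_epsilon_net (eps : R) : 0 < eps -> exists N : nat,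
  forall (I : finType) (x : I -> E) (w : I -> R),
  (forall i, 0 <= w i) -> \sum_i w i = 1 -> exists X : seq E, (size X <= N)%N /\
  forall S : pred I, eps <= \sum_(i | S i) w i ->
  exists2 z, z \in X & convex_closure (x @` [set i | S i]) z.
Proof.
move=> eps0; have [B [beta [beta0 sel]]] := selection.
pose gam := beta * eps ^+ #|B|.
have gam0 : 0 < gam by rewrite mulr_gt0 ?exprn_gt0.
exists (Num.bound gam^-1) => I x w w0 w1.
pose cc (u : {ffun B -> I}) := convex_closure (range (fun b => x (u b))).
pose unhit (X : seq E) (u : {ffun B -> I}) := `[< forall z, z \in X ->
  ~ cc u z >].
pose net (X : seq E) := forall S : pred I, eps <= \sum_(i | S i) w i ->
  exists2 z, z \in X & convex_closure (x @` [set i | S i]) z.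
have H m : exists X, (size X <= m)%N /\ (net X \/ pr w (unhit X) <= 1 - m%:R *
  gam).
  elim: m => [|m [X [sX [nX|uX]]]].
  - by exists [::]; split=> //; right; rewrite mul0r subr0 pr_le1.
  - by exists X; split; [exact: leqW|left].
  case: (pselect (net X)) => [nX|]; first by exists X; split;
    [exact: leqW|left].
  move=> /existsNP[S /not_implyP[epsS nS]].
  pose s := \sum_(i | S i) w i; have s0 : 0 < s by exact: lt_le_trans epsS.
  pose wS i := if S i then w i / s else 0.
  have wS0 i : 0 <= wS i by rewrite /wS; case: ifP => // _;
    rewrite divr_ge0 // ltW.
  have wS1 : \sum_i wS i = 1 by rewrite -big_mkcond -mulr_suml mulfV ?gt_eqF.
  have [z zP] := sel I x wS wS0 wS1.
  exists (z :: X); split; first by rewrite ltnS.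
  right; rewrite -natr1 mulrDl mul1r opprD addrA lerBrDr.
  apply: le_trans uX; rewrite /pr [leRHS](bigID (unhit (z :: X))) /=.
  apply: lerD.
    rewrite le_eqVlt; apply/orP; left; apply/eqP; apply: eq_bigl => u.
    apply/idP/andP => [uz|[]//]; split=> //; move/asboolP: uz => uz.
    by apply/asboolP => y yX; apply: uz; rewrite inE yX orbT.
  pose Q (u : {ffun B -> I}) := `[< cc u z >] && [forall b, S (u b)].
  apply: (@le_trans _ _ (\sum_(u | Q u) \prod_b w (u b))); last first.
    rewrite big_mkcond [leRHS]big_mkcond; apply: ler_sum => u _ /=.
    case: ifP => [/andP[/asboolP zu /forallP Su]|_]; last first.
      by case: ifP => _ //; exact: prod_w_ge0.
    rewrite ifT //; apply/andP; split.
      apply/asboolP => y yX uy; apply: nS; exists y => //.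
      by apply: (convex_closureS _ uy) => _ [b _ <-]; exists (u b) => /=.
    by apply/asboolPn => /(_ z (mem_head _ _)); exact.
  have -> : \sum_(u | Q u) \prod_b w (u b) = s ^+ #|B| * pr wS (fun u =>
    `[< cc u z >]).
    rewrite /pr mulr_sumr [RHS](bigID (fun u : {ffun B ->
      I} => [forall b, S (u b)])) /=.
    rewrite [X in _ = _ + X]big1 ?addr0 => [|u /andP[_ /forallPn[b nSb]]];
      last first.
      by rewrite (bigD1 b) //= /wS (negPf nSb) mul0r mulr0.
    apply: eq_bigr => u /andP[_ /forallP Su].
    rewrite -prodr_const -big_split; apply: eq_bigr => b _ /=.
    by rewrite /wS Su mulrC divfK ?gt_eqF.
  rewrite /gam mulrC; apply: ler_pM => //; [exact/exprn_ge0/ltW|exact: ltW|].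
  by apply: lerXn2r => //; rewrite nnegrE ltW.
have [X [sX [nX|uX]]] := H (Num.bound gam^-1); first by exists X.
have := archi_boundP (ltW _ : 0 <= gam^-1); rewrite invr_gt0 => /(_ gam0).
rewrite -(ltr_pM2r gam0) mulVf ?gt_eqF // => bg.
have : 0 <= pr w (unhit X) by apply: sumr_ge0 => u _; exact: prod_w_ge0.
lra.
Qed.

End Piercing.

(* Halving the weights of the sets pierced in each round makes the total weight
   decay like (1 - beta / 2) ^ t, so no set is pierced too rarely. *)
Lemma fractional_transversal (R : realType) (T : Type) (beta : R) :
  0 < beta <= 1 -> exists2 m : nat, (0 < m)%N &
  forall (I : finType) (K : I -> set T), (0 < #|I|)%N ->
  (forall w : I -> R, (forall i, 0 <= w i) -> \sum_i w i = 1 ->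
     exists x, beta <= \sum_(i | `[< K i x >]) w i) ->
  exists s : seq T, (0 < size s)%N /\
    forall i, (size s <= m * count (fun x => `[< K i x >]) s)%N.
Proof.
move=> /andP[b0 b1]; pose r := 1 - beta / 2.
have r0 : 0 <= r by rewrite /r; lra.
have bern k : r ^+ k * (1 + k%:R * (beta / 2)) <= 1.
  elim: k => [|k IHk]; first by rewrite expr0 mul0r addr0 mulr1.
  apply: le_trans IHk; rewrite exprS -mulrA mulrCA ler_wpM2l ?exprn_ge0 //.
  rewrite /r -natr1; have : 0 <= k%:R * (beta * beta) by rewrite mulr_ge0 //
    ?mulr_ge0 // ltW.
  have : 0 <= beta * beta by rewrite mulr_ge0 // ltW.
  nra.
pose m := Num.bound (6 / beta).
have mb : 6 < m%:R * beta.
  by rewrite -ltr_pdivrMr //; apply: archi_boundP; rewrite divr_ge0 // ltW.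
have m0 : (0 < m)%N.
  by rewrite lt0n; apply: contraTneq mb => ->; rewrite mul0r -leNgt.
have rm : r ^+ m <= 1 / 4.
  have := bern m; have : 0 <= r ^+ m by exact: exprn_ge0.
  nra.
exists m => // I K I0 HK.
pose h (s : seq T) i := count (fun x => `[< K i x >]) s.
pose W s : R := \sum_i 2^-1 ^+ h s i.
have W0 s : 0 < W s.
  case/card_gt0P: I0 => i _; rewrite /W (bigD1 i) //=.
  apply: ltr_pwDl; first by rewrite exprn_gt0 // invr_gt0.
  by apply: sumr_ge0 => j _; rewrite exprn_ge0 // invr_ge0.
have step t : exists s, size s = t /\ W s <= #|I|%:R * r ^+ t.
  elim: t => [|t [s [st sW]]].
    exists [::]; split=> //; rewrite /W expr0 mulr1.
    by under eq_bigr => i _ do rewrite expr0; rewrite sumr_const.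
  have [|| x xP] := HK (fun i => 2^-1 ^+ h s i / W s).
  - by move=> i; rewrite divr_ge0 ?(ltW (W0 _)) // exprn_ge0 // invr_ge0.
  - by rewrite -mulr_suml mulfV // gt_eqF //; exact: W0.
  exists (x :: s); split; first by rewrite /= st.
  move: xP; rewrite -mulr_suml ler_pdivlMr // => xP.
  have -> : W (x :: s) = W s - 2^-1 * \sum_(i | `[< K i x >]) 2^-1 ^+ h s i.
    rewrite /W [X in X - _](bigID (fun i => `[< K i x >])) /=.
    rewrite [LHS](bigID (fun i => `[< K i x >])) /=.
    rewrite (eq_bigr (fun i => 2^-1 * 2^-1 ^+ h s i)) => [|i Kx]; last first.
      by rewrite /h /= Kx add1n exprS.
    rewrite -mulr_sumr.
    rewrite [X in _ + X = _](eq_bigr (fun i => 2^-1 ^+ h s i)) => [|i Kx];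
      last first.
      by rewrite /h /= (negPf Kx).
    by field.
  rewrite exprS mulrCA;
    have : r * W s <= r * (#|I|%:R * r ^+ t) by rewrite ler_wpM2l.
  rewrite {1}/r; lra.
pose n := #|I|.
have [s [sz sW]] := step (m * n)%N.
exists s; split; first by rewrite sz muln_gt0 m0.
move=> i; rewrite sz leq_mul2l; apply/orP; right.
rewrite -/(h s i) leqNgt; apply/negP => hn.
have : 2^-1 ^+ n <= #|I|%:R * r ^+ (m * n) :> R.
  apply: le_trans sW; rewrite /W (bigD1 i) //= ler_wpDr //.
    by apply: sumr_ge0 => j _; rewrite exprn_ge0 // invr_ge0.
  by rewrite ler_wiXn2l ?invr_ge0 // ?(ltnW hn) // invf_le1 // ler1n.
have : r ^+ (m * n) <= 2^-1 ^+ n * 2^-1 ^+ n.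
  rewrite exprM -exprMn; apply: lerXn2r; rewrite ?nnegrE ?exprn_ge0 //.
  by apply: le_trans rm _; lra.
have n0 : 0 < n%:R :> R by rewrite ltr0n.
rewrite -(ler_pM2l n0) => H1 H2; have := le_trans H2 H1.
have p0 : 0 < 2^-1 ^+ n :> R by rewrite exprn_gt0 // invr_gt0.
rewrite mulrA -[leLHS]mul1r ler_pM2r // exprVn ler_pdivlMr ?exprn_gt0 //.
by rewrite mul1r -natrX ler_nat leqNgt ltn_expl.
Qed.

Lemma alon_kleitman (R : realType) (d p : nat) : exists N : nat,
  forall (I : finType) (K : I -> set 'rV[R]_d), (forall i, convex_set (K i)) ->
  (forall y : 'I_p -> I, exists2 phi : 'I_d.+1 -> 'I_p, injective phi &
     exists x, forall j, K (y (phi j)) x) ->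
  exists2 X : seq 'rV[R]_d, (size X <= N)%N &
    forall i, exists2 z, z \in X & K i z.
Proof.
pose T : finType := {phi : {ffun 'I_d.+1 -> 'I_p} | injectiveb phi}.
pose alpha : R := #|T|.+1%:R^-1.
have alpha0 : 0 < alpha by rewrite invr_gt0 ltr0Sn.
pose beta := alpha / d.+2%:R.
have beta01 : 0 < beta <= 1.
  rewrite divr_gt0 ?ltr0Sn //= ler_pdivrMr ?ltr0Sn // mul1r.
  by apply: (@le_trans _ _ 1); rewrite ?invf_le1 ?ler1n // ltr0Sn.
have [m m0 trans] := @fractional_transversal R 'rV[R]_d beta beta01.
have [|N net] := @weak_epsilon_net R d m%:R^-1; first by rewrite invr_gt0 ltr0n.
exists N => I K cK pq.
case: (posnP #|I|) => [I0|I0].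
  by exists [::] => // i; move/eqP: I0; rewrite -leqn0 leqNgt => /card_gt0P[];
    exists i.
have [|s [s0 sP]] := trans I K I0.
  move=> w w0 w1; apply: (fractional_helly w0 w1) => //.
  rewrite -[leLHS]mul1r ler_pdivrMr ?ltr0Sn // mulrC.
  apply: (@le_trans _ _ (#|T|%:R * pr w (fun z : {ffun 'I_d.+1 ->
    I} => `[< exists x, forall j, K (z j) x >]))).
    apply: (pr_union_bound w0 w1 (phi := fun t : T => val t)).
      by move=> t; apply/injectiveP; exact: (valP t).
    move=> y; have [phi /injectiveP iphi [x xK]] := pq y.
    have iphi' : injectiveb (finfun phi).
      by apply/injectiveP => a b; rewrite !ffunE; apply/injectiveP.
    exists (exist _ (finfun phi) iphi'); apply/asboolP; exists x => j.
    by rewrite !ffunE /=; exact: xK.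
  by rewrite ler_wpM2r ?ler_nat // sumr_ge0 // => u _; exact: prod_w_ge0.
have L0 : 0 < (size s)%:R :> R by rewrite ltr0n.
have [||X [sX XP]] := net 'I_(size s) (fun j =>
  tnth (in_tuple s) j) (fun=> (size s)%:R^-1).
- by move=> j; rewrite invr_ge0 ltW.
- by rewrite sumr_const card_ord -[LHS]mulr_natr mulVf ?gt_eqF.
exists X => // i.
have [|z zX zP] := XP (fun j => `[< K i (tnth (in_tuple s) j) >]); last first.
  by exists z => //; apply: zP => // _ [j /asboolP Kj <-].
rewrite sumr_const -[leRHS]mulr_natr ler_pdivlMl // ler_pdivrMr ?ltr0n //
  -natrM ler_nat.
by rewrite mulnC -sum1_card; have := sP i; rewrite -sum1_count big_tnth.
Qed.

(** * Crossing by flats *)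

Lemma flatten_family (A : finType) (T : eqType) (S : A -> seq T) (n : nat) :
  (forall a, (size (S a) <= n)%N) ->
  exists2 X : seq T, (size X <= #|A| * n)%N &
    forall x, x \in X <-> exists a, x \in S a.
Proof.
move=> Sn; exists (flatten [seq S a | a <- index_enum A]).
  rewrite size_flatten /shape sumnE !big_map.
  by rewrite -sum_nat_const; apply: leq_sum => a _.
move=> x; split=> [/flatten_mapP[a _ xa]|[a xa]]; first by exists a.
by apply/flatten_mapP; exists a => //; exact: mem_index_enum.
Qed.

Lemma pigeonhole (q n d : nat) (a : 'I_q -> 'I_n) : (n * d < q)%N ->
  exists2 tau : 'I_d.+1 ->
    'I_q, injective tau & exists b, forall k, a (tau k) = b.
Proof.
move=> nd; have [b bd] : exists b, (d < #|[pred j | a j == b]|)%N.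
  apply/existsP; apply: contraLR nd; rewrite negb_exists -leqNgt => /forallP ab.
  rewrite -[q]card_ord -sum1_card (partition_big a predT) //=.
  rewrite -[X in (_ <= X * _)%N](card_ord n) -sum_nat_const.
  apply: leq_sum => b _; have := ab b; rewrite -leqNgt; apply: leq_trans.
  by rewrite sum1_card.
exists (fun k => enum_val (widen_ord bd k)).
  by move=> k l /enum_val_inj/(congr1 val) /= /val_inj.
by exists b => k; have := enum_valP (widen_ord bd k); rewrite inE => /eqP.
Qed.

Section Flats.
Variables (R : realType) (d : nat).
Local Notation E := 'rV[R]_d.

Definition flat_set (f : E * {vspace E}) : set E := [set x | x - f.1 \in f.2].

Lemma convex_flat_set f : convex_set (flat_set f).
Proof.
apply/convex_setP => x y t _ xf yf; rewrite /flat_set /=.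
have -> : t *: x + (1 - t) *: y - f.1 = t *: (x - f.1) + (1 - t) *: (y - f.1).
  by rewrite !scalerBr addrACA -opprD -scalerDl addrCA subrr addr0 scale1r.
by apply: memvD; apply: memvZ.
Qed.

Lemma hyperplane_section (p : E) (U : {vspace E}) (e : nat) (b : E) (g : R) :
  \dim U = e.+1 ->
  exists s : seq (E * {vspace E}), [/\ (size s <= 1)%N,
    (forall f, f \in s -> \dim f.2 = e) &
    (exists2 u, u \in U & dot b u != 0) -> forall y, flat_set (p, U) y ->
      dot b y = g -> exists2 f, f \in s & flat_set f y].
Proof.
move=> dU.
case: (pselect (exists2 u, u \in U & dot b u != 0)) => [[u uU bu]|n];
  last by exists [::].
pose F : 'Hom(E, 'rV[R]_1) := linfun (mulmxr b^T).
have FE v : F v = (dot b v)%:M.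
  rewrite lfunE /=; apply/matrixP => i j;
    rewrite !ord1 !mxE eqxx mulr1n /dot big_ord1.
  by apply: eq_bigr => k _; rewrite !mxE mulrC.
have kF v : (v \in lker F) = (dot b v == 0).
  rewrite memv_ker FE; apply/eqP/eqP => [/matrixP/(_ 0 0)|->].
    by rewrite !mxE eqxx mulr1n.
  by rewrite -scalemx1 scale0r.
pose t := (g - dot b p) / dot b u.
exists [:: (p + t *: u, (U :&: lker F)%VS)]; split=> // [f|_ y yU yg].
  rewrite inE => /eqP -> /=; apply/eqP; rewrite -eqSS -dU -(limg_ker_dim F U).
  rewrite -addn1 eqn_add2l eqn_leq; apply/andP; split.
    rewrite lt0n dimv_eq0; apply: contra bu => /eqP F0.
    by rewrite -kF memv_ker -memv0 -F0 memv_img.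
  by apply: (leq_trans (dimvS (subvf _))); rewrite dimvf.
eexists; first exact: mem_head.
rewrite /flat_set /= memv_cap kF opprD addrA memvB ?memvZ //=.
by rewrite !dotDr !dotNr dotZr /t divfK // yg; apply/eqP; ring.
Qed.

(* By Gordan's alternative, convex sets A_0, ..., A_n with no common point in
   the flat are contained in halfspaces with no common point in the flat.  A
   convex set meeting all the A_j in the flat meets all these halfspaces but is
   not contained in all of them, so it crosses the boundary of one of them. *)
Lemma crossing_hyperplanes (p : E) (U : {vspace E}) (e n : nat) (I : finType)
    (A : 'I_n.+1 -> set E) (x : I -> 'I_n.+1 -> E) :
  \dim U = e.+1 -> (forall j, convex_set (A j)) ->
  (forall i j, A j (x i j)) -> (forall i j, flat_set (p, U) (x i j)) ->
  ~ (exists2 y, flat_set (p, U) y & forall j, A j y) ->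
  exists X : seq (E * {vspace E}), [/\ (size X <= n.+1)%N,
    (forall f, f \in X -> \dim f.2 = e) &
    forall i (K : set E), convex_set K -> (forall j, K (x i j)) ->
      exists2 f, f \in X & K `&` flat_set f !=set0].
Proof.
move=> dU cA xA xU noA.
case: (pickP (@predT I)) => [i0 _|I0]; last by exists [::]; split=> // i;
  have := I0 i.
pose D (c : {ffun 'I_n.+1 -> I}) : 'M[R]_(n.+1, d) :=
  \matrix_j (x (c j) j - x (c ord0) ord0).
have [|a aD] := @gordan R n.+1 d _ D.
  move=> [l lw D0].
  pose y j := \sum_(c : {ffun 'I_n.+1 -> I}) l c *: x (c j) j.
  have yE j : y j = y ord0.
    apply/eqP; rewrite -subr_eq0; apply/eqP.
    have := congr1 (row j) D0; rewrite linear_sum linear0 /= => H;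
      rewrite [RHS]H.
    rewrite -sumrB; apply: eq_bigr => c _.
    by rewrite -scalerBr; apply/rowP => k; rewrite /D !mxE.
  have yH j : hull (fun c : {ffun 'I_n.+1 ->
    I} => x (c j) j) xpredT (y j) by exists l.
  apply: noA; exists (y ord0).
    by apply: (hull_sub_convex (@convex_flat_set (p, U)) _ (yH ord0)).
  by move=> j; rewrite -(yE j); apply: (hull_sub_convex (cA j) _ (yH j)).
pose S := \sum_j row j a.
pose b j := row j a - (if j == ord0 then S else 0).
have b0 : \sum_j b j = 0.
  by rewrite sumrB -/S [X in _ - X](bigD1 ord0) //= big1 ?addr0 ?subrr // =>
    j /negPf ->.
have bD (c : {ffun 'I_n.+1 -> I}) : \sum_j dot (b j) (x (c j) j) = dot a (D c).
  rewrite /dot [RHS](eq_bigr (fun j =>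
    dot (row j a) (x (c j) j - x (c ord0) ord0))); last first.
    by move=> j _; rewrite /dot big_ord1; apply: eq_bigr => k _; rewrite !mxE.
  under [RHS]eq_bigr => j _ do rewrite dotDr.
  rewrite big_split /=.
  have -> : \sum_j dot (row j a) (- x (c ord0) ord0) = - dot S (x (c ord0)
    ord0).
    rewrite -dotNr /S dotC dot_sumr; apply: eq_bigr => j _; exact: dotC.
  rewrite -/(dot _ _).
  transitivity (\sum_j (dot (row j a) (x (c j) j) -
      (if j == ord0 then dot S (x (c ord0) ord0) else 0))).
    apply: eq_bigr => j _; rewrite -/(dot _ _) /b; case: eqP => [->|_].
      by rewrite dotDl dotNl.
    by rewrite !subr0.
  rewrite sumrB; congr (_ - _).
  by rewrite (bigD1 ord0) //= big1 ?addr0 // => j /negPf ->.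
pose cm : {ffun 'I_n.+1 ->
  I} := [ffun j => [arg min_(i < i0) dot (b j) (x i j)]%O].
pose g j := dot (b j) (x (cm j) j).
have gle i j : g j <= dot (b j) (x i j).
  by rewrite /g ffunE; case: arg_minP => // k _; exact.
have g0 : 0 < \sum_j g j by rewrite bD.
have /choice[s sP] := fun j => hyperplane_section p (b j) (g j) dU.
have [|X Xn XP] := @flatten_family _ _ s 1; first by move=> j; case: (sP j).
exists X; split; first by rewrite card_ord muln1 in Xn.
  by move=> f /XP[j]; case: (sP j) => _ + _; apply.
move=> i K /convex_setP cK Kx; pose z := x i ord0.
have [j jz] : exists j, dot (b j) z < g j.
  apply/existsP; apply: contraTT g0; rewrite negb_exists -leNgt => /forallP H.
  apply: (@le_trans _ _ (\sum_j dot (b j) z)).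
    by apply: ler_sum => j _; rewrite leNgt.
  have -> : \sum_j dot (b j) z = dot z (\sum_j b j).
    by rewrite dot_sumr; apply: eq_bigr => j _; exact: dotC.
  by rewrite b0 dot0r.
pose u := x i j - z.
have uU : u \in U.
  have -> : u = (x i j - p) - (z - p) by rewrite /u opprB addrA subrK.
  by apply: memvB; exact: xU.
have bu : 0 < dot (b j) u.
  by rewrite /u dotDr dotNr subr_gt0; exact: lt_le_trans (gle i j).
pose t := (g j - dot (b j) z) / dot (b j) u.
have t01 : 0 <= t <= 1.
  rewrite divr_ge0 ?(ltW bu) ?subr_ge0 ?(ltW jz) //= ler_pdivrMr // mul1r.
  by rewrite /u dotDr dotNr lerD2r.
pose y := t *: x i j + (1 - t) *: z.
have yE : y = z + t *: u.
  by rewrite /y scalerBl scale1r /u scalerBr addrCA.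
have [_ _] := sP j; case/(_ _ y); first by exists u => //; rewrite gt_eqF.
- by have /convex_setP := @convex_flat_set (p, U); apply => //; exact: xU.
- by rewrite yE dotDr dotZr /t divfK ?gt_eqF // addrCA subrr addr0.
move=> f fs fy; exists f; first by apply/XP; exists j.
by exists y; split=> //; apply: cK t01 (Kx j) (Kx ord0).
Qed.

Fixpoint crossing_bound (r : nat) : nat :=
  if r is r'.+1 then
    (crossing_bound r' * ((crossing_bound r' * d).+1 ^ d.+1) * d.+1)%N
  else 1%N.

Lemma rainbow_crossing (m r : nat) (B : nat -> nat -> set E) :
  (0 < m)%N -> (r <= d)%N ->
  (forall l, (l < r)%N -> (crossing_bound l * d < m)%N) ->
  (forall l j, convex_set (B l j)) ->
  (forall l (tau : 'I_d.+1 -> nat), (l < r)%N -> injective tau ->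
    (forall k, (tau k < m)%N) -> ~ exists x, forall k, B l (tau k) x) ->
  forall (I : finType) (K : I -> set E), (forall i, convex_set (K i)) ->
  (forall i (t : nat -> nat), (forall l, (t l < m)%N) ->
    exists x, K i x /\ forall l, (l < r)%N -> B l (t l) x) ->
  exists X : seq (E * {vspace E}), [/\ (size X <= crossing_bound r)%N,
    (forall f, f \in X -> \dim f.2 = d - r)%N &
    forall i, exists2 f, f \in X & K i `&` flat_set f !=set0].
Proof.
move=> m0 + + cB; elim: r => [|r IHr] rd rm noB I K cK meetK.
  exists [:: (0, fullv)]; split=> // [f|i].
    by rewrite inE => /eqP -> /=; rewrite dimvf /dim /= mul1n subn0.
  exists (0, fullv); first exact: mem_head.
  have [x [Kx _]] := meetK i (fun=> 0%N) (fun=> m0).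
  by exists x; split=> //; rewrite /flat_set /= memvf.
pose q := (crossing_bound r * d).+1.
have qm : (q <= m)%N by exact: rm.
pose K' (ij : I * 'I_q) := K ij.1 `&` B r ij.2.
have [|||||X0 [X0n X0d X0P]] := IHr _ _ _ (I * 'I_q)%type K'.
- exact: ltnW.
- by move=> l lr; apply: rm; exact: leqW.
- by move=> l tau lr; apply: noB; exact: leqW.
- move=> [i j]; apply/convex_setP => x y t t01 [/= Kx Bx] [Ky By]; split.
    by have /convex_setP := cK i; apply.
  by have /convex_setP := cB r j; apply.
- move=> [i j] t tm; have [|x [Kx xB]] := meetK i (fun l =>
    if l == r then j : nat else t l).
    by move=> l; case: eqP => // _; exact: leq_trans (ltn_ord j) qm.
  exists x; split=> [|l lr].
    by split=> //=; have := xB r (leqnn _); rewrite eqxx.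
  by have := xB l (leqW lr); rewrite ltn_eqF.
pose fl (a : 'I_(size X0)) := tnth (in_tuple X0) a.
have step (c : 'I_(size X0) * {ffun 'I_d.+1 ->
  'I_q}) : exists X : seq (E * {vspace E}),
  [/\ (size X <= d.+1)%N, (forall f, f \in X -> \dim f.2 = d - r.+1)%N &
   injective c.2 -> forall i, (forall k, exists y, [/\ K i y,
     B r (c.2 k) y & flat_set (fl c.1) y]) ->
     exists2 f, f \in X & K i `&` flat_set f !=set0].
  case: c => a tau /=; case: (pselect (injective tau)) => [itau|];
    last by exists [::].
  pose P i := `[< forall k, exists y, [/\ K i y,
    B r (tau k) y & flat_set (fl a) y] >].
  have xP (i : {i | P i}) : exists x : 'I_d.+1 -> E, forall k,
      [/\ K (val i) (x k), B r (tau k) (x k) & flat_set (fl a) (x k)].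
    by have /asboolP H := valP i; have [x xP] := choice H; exists x.
  have {xP} /choice[x xP] := xP.
  have [||||| X [Xn Xd XP]] := @crossing_hyperplanes (fl a).1 (fl a).2 (d -
    r.+1) d
      {i | P i} (fun k => B r (tau k)) x.
  - rewrite subnSK //; apply: X0d; exact: mem_tnth.
  - by move=> j; exact: cB.
  - by move=> i j; case: (xP i j).
  - by move=> i j; case: (xP i j); rewrite -surjective_pairing.
  - move=> [y _ yB]; apply: (noB r (fun k => tau k)) => //; last by exists y.
      by move=> k l /val_inj/itau.
    by move=> k; exact: leq_trans (ltn_ord _) qm.
  exists X; split=> // _ i iP.
  have Pi : P i by apply/asboolP.
  by apply: (XP (exist _ i Pi) (K i)) => // k; case: (xP (exist _ i Pi) k).
have {step} /choice[S SP] := step.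
have [|X Xn XP] := @flatten_family _ _ S d.+1; first by move=> c; case: (SP c).
exists X; split=> [|f /XP[c]|i].
- apply: (leq_trans Xn); rewrite leq_mul2r card_prod card_ffun !card_ord /=.
  by rewrite leq_mul2r X0n orbT.
- by case: (SP c) => _ + _; apply.
have /choice[a aP] : forall j : 'I_q, exists a,
  K i `&` B r j `&` flat_set (fl a) !=set0.
  move=> j; have [f /(nthP f)[n nX <-] fK] := X0P (i, j).
  by exists (Ordinal nX); rewrite /fl (tnth_nth f).
have [|tau itau [b tb]] := @pigeonhole q (size X0) d a.
  by rewrite ltnS leq_mul2r X0n orbT.
have [_ _] := SP (b, finfun tau); case/(_ _ i) => /=.
- by move=> k l; rewrite !ffunE => /itau.
- move=> k; rewrite ffunE; have [y [[Ky By] fy]] := aP (tau k).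
  by exists y; split=> //; rewrite -(tb k).
by move=> f fS Kf; exists f => //; apply/XP; exists (b, finfun tau).
Qed.

End Flats.

(** * Colorful families *)

Lemma card_le_seq (T : choiceType) (s : seq T) (n : nat) :
  (size s <= n)%N -> ([set` s] #<= `I_n)%card.
Proof.
case: s => [|x s] sn; first by rewrite set_nil; exact: card_ge0.
apply: (@card_le_trans _ _ _ `I_(size (x :: s))); last first.
  by apply: subset_card_le => i /= /leq_trans; apply.
apply: (card_le_trans _ (card_image_le (nth x (x :: s)) _)).
by apply: subset_card_le => _ /(nthP x)[i ii <-]; exists i.
Qed.

Lemma pierced_union (T : choiceType) (I : finType) (P : set I) (n : nat)
    (C : I -> set (set T)) :
  (forall i, P i -> exists2 X : seq T,
    (size X <= n)%N & pierces [set` X] (C i)) ->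
  pierced_by_points (#|I| * n) (\bigcup_(i in P) C i).
Proof.
move=> H; have /choice[S SP] : forall i, exists X : seq T, (size X <= n)%N /\
    (P i -> pierces [set` X] (C i)).
  move=> i; case: (pselect (P i)) => [/H[X Xn XC]|nP]; first by exists X.
  by exists [::].
have [|X Xn XP] := @flatten_family _ _ S n; first by move=> i; case: (SP i).
exists [set` X]; first exact: card_le_seq.
move=> K [i Pi CK]; have [_ /(_ Pi) /(_ _ CK)[x /= xS Kx]] := SP i.
by exists x => //=; apply/XP; exists i.
Qed.

Lemma crossed_union (R : realType) (d k n : nat) (I : finType) (P : set I)
    (C : I -> set (set 'rV[R]_d)) :
  (forall i, P i -> exists X : seq ('rV[R]_d * {vspace 'rV[R]_d}),
     [/\ (size X <= n)%N, (forall f, f \in X -> \dim f.2 = k) &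
      forall K, C i K -> exists2 f, f \in X & K `&` flat_set f !=set0]) ->
  crossed_by_flats k (#|I| * n) (\bigcup_(i in P) C i).
Proof.
move=> H; have /choice[S SP] : forall i,
  exists X : seq ('rV[R]_d * {vspace 'rV[R]_d}),
    [/\ (size X <= n)%N, (forall f, f \in X -> \dim f.2 = k) &
     P i -> forall K, C i K -> exists2 f, f \in X & K `&` flat_set f !=set0].
  move=> i; case: (pselect (P i)) => [/H[X [Xn Xk XC]]|nP]; first by exists X.
  by exists [::].
have [|X Xn XP] := @flatten_family _ _ S n; first by move=> i; case: (SP i).
exists (@flat_set R d @` [set` X]); split.
- exact: card_le_trans (card_image_le _ _) (card_le_seq Xn).
- move=> _ [f /= /XP[i fi] <-]; exists f.1, f.2; split=> //.
  by case: (SP i) => _ + _; apply.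
- move=> K [i Pi CK]; have [_ _ /(_ Pi) /(_ _ CK)[f fS fK]] := SP i.
  by exists (flat_set f) => //; exists f => //=; apply/XP; exists i.
Qed.

Lemma sorting_perm (n : nat) (G : pred 'I_n) :
  exists s : {perm 'I_n}, forall j : 'I_n, G (s j) = (j < #|G|)%N.
Proof.
pose L := enum G ++ enum (predC G).
have sL : size L = n by rewrite size_cat -!cardE cardC card_ord.
have uL : uniq L.
  rewrite cat_uniq !enum_uniq andbT /=; apply/hasPn => i; rewrite !mem_enum.
  by rewrite !inE.
have inj : injective (fun j : 'I_n => nth j L j).
  move=> i j /eqP; rewrite (set_nth_default i j) ?sL //.
  by rewrite nth_uniq ?sL // => /eqP/val_inj.
exists (perm inj) => j; rewrite permE nth_cat -cardE; case: ltnP => jG.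
  have : nth j (enum G) j \in enum G by rewrite mem_nth // -cardE.
  by rewrite mem_enum.
have : nth j (enum (predC G)) (j - #|G|) \in enum (predC G).
  by rewrite mem_nth // -cardE -(ltn_add2l #|G|) subnKC // cardC card_ord.
by rewrite mem_enum inE => /negbTE.
Qed.

Theorem theorem8 (R : realType) :
  exists f g : nat -> nat -> nat,
  forall (d : nat), (1 <= d)%N ->
  forall (F : set (set 'rV[R]_d)) (C : 'I_d.+1 -> set (set 'rV[R]_d)),
    finite_set F ->
    colored F C ->
    (forall i, C i !=set0) ->
    (forall K, F K -> convex_set K) ->
    colorful_helly C ->
  exists (k : nat) (s : {perm 'I_d.+1}),
    [/\ (1 <= k <= d)%N,
        pierced_by_points (f k d)
          (\bigcup_(j in [set j : 'I_d.+1 | (j < k)%N]) C (s j)) &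
        crossed_by_flats k (g k d)
          (\bigcup_(j in [set j : 'I_d.+1 | (k <= j)%N]) C (s j))].
Proof.
pose M d r := crossing_bound d r.
pose m d := (\max_(r < d.+1) M d r * d).+1.
have mM d r : (r <= d)%N -> (M d r * d < m d)%N.
  rewrite -ltnS => rd; rewrite ltnS.
  exact: (leq_bigmax (F := fun r : 'I_d.+1 => M d r * d)%N (Ordinal rd)).
have /choice[N NP] := fun d => alon_kleitman R d (m d).
exists (fun _ d => #|'I_d.+1| * N d)%N, (fun k d => #|'I_d.+1| * M d (d - k))%N.
move=> d d1 F C finF colF C0 cF CH.
have CF i K : C i K -> F K by rewrite colF; exists i.
have cC i K : C i K -> convex_set K by move=> /CF/cF.
pose good i := `[< forall y : 'I_(m d) -> set 'rV[R]_d, (forall j, C i (y j)) ->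
  exists2 phi : 'I_d.+1 -> 'I_(m d), injective phi &
    exists x, forall j, y (phi j) x >].
have pierce_good i : good i ->
    exists2 X : seq 'rV[R]_d, (size X <= N d)%N & pierces [set` X] (C i).
  move=> /asboolP gi.
  have /finite_seqP[s sC] : finite_set (C i).
    by apply: sub_finite_set finF => K; exact: CF.
  have Cs j : C i (tnth (in_tuple s) j) by rewrite sC /= mem_tnth.
  have [j|y|X XN XP] := NP d 'I_(size s) (fun j => tnth (in_tuple s) j).
  - exact: (cC i).
  - by have [|phi iphi ?] := gi (fun j => tnth (in_tuple s) (y j));
      last by exists phi.
  exists X => // K; rewrite sC /= => /(tnthP (in_tuple s))[j ->];
    have [z zX Kz] := XP j.
  by exists z.
have bad_ex i : exists y : nat -> set 'rV[R]_d, (forall j, C i (y j)) /\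
    (~~ good i -> forall tau : 'I_d.+1 -> nat, injective tau ->
      (forall k, (tau k < m d)%N) -> ~ exists x, forall k, y (tau k) x).
  case: (boolP (good i)) => [_|/asboolPn/existsNP[y /not_implyP[yC ny]]].
    by have [K KC] := C0 i; exists (fun=> K).
  exists (fun j => y (inord j)); split=> // _ tau itau taum [x xy]; apply: ny.
  exists (fun k => inord (tau k)).
    move=> k l /(congr1 val); rewrite /= !inordK;
      [exact: itau|exact: taum|exact: taum].
  by exists x.
have /choice[Y YP] := bad_ex.
pose k0 := #|good|.
have cross_bad i : ~~ good i -> exists X : seq ('rV[R]_d * {vspace 'rV[R]_d}),
     [/\ (size X <= M d (d - k0))%N, (forall f, f \in X -> \dim f.2 = k0) &
      forall K, C i K -> exists2 f, f \in X & K `&` flat_set f !=set0].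
  move=> bi; pose bads := enum [predD1 predC good & i].
  have ksb : (k0 + size bads)%N = d.
    apply/succn_inj; rewrite -addnS -cardE -[in RHS](card_ord d.+1) -(cardC
      good).
    by rewrite (cardD1 i (predC good)) (bi : i \in predC good).
  have sb : size bads = (d - k0)%N by have := addKn k0 (size bads); rewrite ksb.
  have kd : (k0 <= d)%N by have := leq_addr (size bads) k0; rewrite ksb.
  have badsP l : (l < d - k0)%N ->
    (nth i bads l != i) && ~~ good (nth i bads l).
    by rewrite -sb => lb; have := mem_nth i lb; rewrite mem_enum.
  have /finite_seqP[s sC] : finite_set (C i).
    by apply: sub_finite_set finF => K; exact: CF.
  have Cs j : C i (tnth (in_tuple s) j) by rewrite sC /= mem_tnth.
  have [|||||||X [XM Xd XP]] := @rainbow_crossing R d (m d) (d - k0)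
    (fun l => Y (nth i bads l)) _ _ _ _ _ 'I_(size s) (fun j =>
      tnth (in_tuple s) j).
  - by [].
  - exact: leq_subr.
  - by move=> l ld; apply: mM; exact: leq_trans (ltnW ld) (leq_subr _ _).
  - by move=> l j; apply: (cC (nth i bads l)); case: (YP (nth i bads l)).
  - move=> l tau ld; have [_] := YP (nth i bads l); apply.
    by have /andP[] := badsP l ld.
  - by move=> j; apply: (cC i).
  - move=> j t tm.
    pose K c := if c == i then tnth (in_tuple s) j else Y c (t (index c bads)).
    have [|x xK] := CH K.
      by move=> c; rewrite /K; case: eqP => [->//|_]; case: (YP c).
    exists x; split=> [|l ld]; first by have := xK i Logic.I; rewrite /K eqxx.
    have := xK (nth i bads l) Logic.I; rewrite /K.
    have /andP[/negPf -> _] := badsP l ld.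
    by rewrite index_uniq ?sb // enum_uniq.
  exists X; split=> // [f fX|K]; first by rewrite Xd // subKn.
  by rewrite sC /= => /(tnthP (in_tuple s))[j ->]; exact: XP.
have k0_gt0 : (0 < k0)%N.
  rewrite lt0n; apply/negP => /eqP k00.
  have b0 : ~~ good ord0 by apply/negP => g0; have := card0_eq k00 ord0;
    rewrite (g0 : ord0 \in good).
  have [X [Xn Xd XP]] := cross_bad _ b0; rewrite k00 subn0 in Xn Xd.
  have [YC /(_ b0) noY] := YP ord0.
  have /choice[a aP] : forall j : 'I_(m d), exists a : 'I_(size X),
    Y ord0 j (tnth (in_tuple X) a).1.
    move=> j; have [f fX [y [Yy fy]]] := XP _ (YC j).
    case/(nthP f): (fX) => n nX nf; exists (Ordinal nX).
    rewrite (tnth_nth f) /= nf; suff -> : f.1 = y by [].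
    apply/esym/eqP; rewrite -subr_eq0 -memv0.
    have /eqP := Xd _ fX; rewrite dimv_eq0 => /eqP <-; exact: fy.
  have [|tau itau [b tb]] := @pigeonhole (m d) (size X) d a.
    by apply: leq_ltn_trans (mM d d (leqnn _)); rewrite leq_mul2r Xn orbT.
  apply: (noY (fun k => tau k)) => //; first by move=> k l /val_inj/itau.
  by exists (tnth (in_tuple X) b).1 => k; rewrite -(tb k).
have [s sP] := sorting_perm good.
case: (leqP k0 d) => kd.
  exists k0, s; split; first by rewrite k0_gt0.
    by apply: pierced_union => j /= jk; apply: pierce_good; rewrite sP.
  by apply: crossed_union => j /= jk; apply: cross_bad; rewrite sP -leqNgt.
exists d, 1%g; split; first by rewrite d1 leqnn.
  apply: pierced_union => j _; apply: pierce_good; rewrite perm1.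
  apply: contraLR kd => bj; rewrite -leqNgt -ltnS -[leqRHS](card_ord d.+1).
  by rewrite -(cardC good) -addn1 leq_add2l; apply/card_gt0P; exists j.
apply: crossed_union => j _; exists [:: (0, fullv)]; split=> //.
- by rewrite subnn.
- by move=> f; rewrite inE => /eqP -> /=; rewrite dimvf /dim /= mul1n.
move=> K CK; exists (0, fullv); first exact: mem_head.
have /choice[L LC] := C0.
have [|x xL] := CH (fun c => if c == (1%g : {perm 'I_d.+1}) j then K else L c).
  by move=> c; case: eqP => [->|].
by exists x; split; [have := xL ((1%g : {perm 'I_d.+1}) j) Logic.I;
  rewrite eqxx|rewrite /flat_set /= memvf].
Qed.
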